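(* Consider a locally o-minimal expansion of the ordered group of reals $(\mathbb R,<,0,+)$. For any definable subset $X$ of $\mathbb R^{n+1}$ there exist a positive real $r$ and a positive integer $K$ such that for every $a\in\mathbb R^n$ the set $X\cap(\{a\}\times\,]-r,r[)$ has at most $K$ connected components.
   Context: ''Definable'' means definable with parameters; locally o-minimal means that for every definable $X\subset\mathbb R$ and every $a\in\mathbb R$ there is an open interval $I\ni a$ with $X\cap I$ a finite union of points and open intervals. $]-r,r[$ denotes the open interval $\{y:-r<y<r\}$. *)

(* Defs.v *)
From HB Require Import structures.
From mathcomp Require Import all_boot all_order all_algebra.
From mathcomp Require Import all_classical all_reals all_analysis.

Set Implicit Arguments.
Unset Strict Implicit.
Unset Printing Implicit Defensive.

Import Order.TTheory GRing.Theory Num.Theory.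
Import numFieldNormedType.Exports.

Local Open Scope classical_set_scope.
Local Open Scope ring_scope.

(* An expansion of (R, <, 0, +): arbitrary additional function and relation
   symbols with their interpretations.  The symbols <, 0, + (and equality) are
   built into the terms and formulas below, with their standard meaning. *)
Record expansion (R : realType) := Expansion {
  fsym : Type;
  farity : fsym -> nat;
  finterp : forall f : fsym, ('I_(farity f) -> R) -> R;
  rsym : Type;
  rarity : rsym -> nat;
  rinterp : forall p : rsym, ('I_(rarity p) -> R) -> Prop
}.

Section FirstOrder.
Variables (R : realType) (S : expansion R).

Inductive term : Type :=
| TVar of nat
| TZero
| TAdd of term & term
| TApp (f : fsym S) of ('I_(farity f) -> term).

Inductive formula : Type :=
| FEq of term & term
| FLt of term & term
| FRel (p : rsym S) of ('I_(rarity p) -> term)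
| FNot of formula
| FAnd of formula & formula
| FEx of nat & formula.

Fixpoint teval (v : nat -> R) (t : term) : R :=
  match t with
  | TVar i => v i
  | TZero => 0
  | TAdd t1 t2 => teval v t1 + teval v t2
  | TApp f ts => finterp (fun j => teval v (ts j))
  end.

Definition update (v : nat -> R) (i : nat) (c : R) : nat -> R :=
  fun j => if j == i then c else v j.

Fixpoint sat (v : nat -> R) (phi : formula) : Prop :=
  match phi with
  | FEq t1 t2 => teval v t1 = teval v t2
  | FLt t1 t2 => teval v t1 < teval v t2
  | FRel p ts => rinterp (fun j => teval v (ts j))
  | FNot psi => ~ sat v psi
  | FAnd psi1 psi2 => sat v psi1 /\ sat v psi2
  | FEx i psi => exists c : R, sat (update v i c) psi
  end.

(* The valuation reading variables 0, ..., n-1 in x and the others in p. *)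
Definition valuation n (x : 'rV[R]_n) (p : nat -> R) : nat -> R :=
  fun i => if insub i is Some j then x ord0 j else p i.

(* The values of p at the (finitely many) variables of index >= n that occur
   free in phi are the parameters. *)
Definition definable n (X : set 'rV[R]_n) : Prop :=
  exists (phi : formula) (p : nat -> R),
    X = [set x | sat (valuation x p) phi].

Definition definable1 (X : set R) : Prop :=
  definable [set x : 'rV[R]_1 | X (x ord0 ord0)].

End FirstOrder.

(* Open intervals are nonempty and may be unbounded. *)
Definition open_interval (R : realType) (I : set R) : Prop :=
  exists a b : \bar R, (a < b)%E /\ I = [set x | (a < x%:E < b)%E].

Definition finite_union_points_intervals (R : realType) (X : set R) : Prop :=
  exists (m : nat) (J : nat -> set R),
    (forall i, (i < m)%N -> (exists c : R, J i = [set c]) \/ open_interval (J i))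
    /\ X = \bigcup_(i in `I_m) J i.

Definition locally_ominimal (R : realType) (S : expansion R) : Prop :=
  forall X : set R, definable1 S X ->
  forall a : R, exists I : set R,
    [/\ open_interval I, I a & finite_union_points_intervals (X `&` I)].

Definition components (T : topologicalType) (A : set T) : set (set T) :=
  [set connected_component A x | x in A].

(* Main.v *)
(** Over the reals, a definable subset of the line has a discrete frontier, and a
    countable definable set is discrete, hence finite if bounded.  The frontiers
    of the fibers [X_a] in ]-1, 1[ thus form a definable family of finite subsets
    of ]-1, 1[, and it suffices to bound the cardinality of such a family
    [A_(a, s)] uniformly, by induction on the number of parameters.  For fixed [a],
    call [s] a jump when [A_(a, s)] is not matched bijectively with [A_(a, t)] at
    small distance for all [t] near [s].  Testing [A_(a, s)] against rational
    intervals shows that the jumps lie in a countable union of frontiers of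
    definable sets, so they form a countable definable set.  The union of the
    [A_(a, c)] over the jumps [c] and over one [c] in each component of the
    complement of the jumps is countable, definable and bounded, hence finite;
    by induction its cardinality is bounded uniformly in [a], and it bounds that
    of every [A_(a, s)], which is constant in [s] between consecutive jumps. *)

Require Import Defs.
From HB Require Import structures.
From mathcomp Require Import all_boot all_order all_algebra.
From mathcomp Require Import all_classical all_reals all_analysis.
From mathcomp Require Import lra.

Set Implicit Arguments.
Unset Strict Implicit.
Unset Printing Implicit Defensive.

Import Order.TTheory GRing.Theory Num.Theory.
Import numFieldNormedType.Exports.

Local Open Scope classical_set_scope.
Local Open Scope card_scope.
Local Open Scope ring_scope.

(** * Definability *)

Section Renaming.
Variables (R : realType) (S : expansion R).
Implicit Types (v w : nat -> R) (t : term S) (phi : formula S).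

Lemma teval_finite_support t : exists M : nat, forall v w,
  (forall i, (i < M)%N -> v i = w i) -> teval v t = teval w t.
Proof.
elim: t => [i||t1 [M1 h1] t2 [M2 h2]|f ts ih] /=.
- by exists i.+1 => v w; apply.
- by exists 0%N.
- exists (maxn M1 M2) => v w vw; congr (_ + _).
  + by apply: h1 => i iM; apply: vw; rewrite leq_max iM.
  + by apply: h2 => i iM; apply: vw; rewrite leq_max iM orbT.
- have [M hM] := choice ih.
  exists (\max_j M j) => v w vw; congr finterp; apply/funext => j.
  by apply: hM => i iM; apply/vw/(leq_trans iM)/leq_bigmax.
Qed.

(** Bounds the variables that matter to [phi], so that a fresh one can be chosen when renaming under
    a quantifier. *)
Lemma sat_finite_support phi : exists M : nat, forall v w,
  (forall i, (i < M)%N -> v i = w i) -> sat v phi <-> sat w phi.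
Proof.
elim: phi => [t1 t2|t1 t2|p ts|phi [M h]|phi1 [M1 h1] phi2 [M2 h2]|k phi [M h]] /=.
- have [M1 h1] := teval_finite_support t1; have [M2 h2] := teval_finite_support t2.
  exists (maxn M1 M2) => v w vw.
  rewrite (h1 v w) 1?(h2 v w)// => i iM; apply: vw; rewrite leq_max iM ?orbT//.
- have [M1 h1] := teval_finite_support t1; have [M2 h2] := teval_finite_support t2.
  exists (maxn M1 M2) => v w vw.
  rewrite (h1 v w) 1?(h2 v w)// => i iM; apply: vw; rewrite leq_max iM ?orbT//.
- have [M hM] := choice (fun j => teval_finite_support (ts j)).
  exists (\max_j M j) => v w vw.
  suff -> : (fun j => teval v (ts j)) = (fun j => teval w (ts j)) by [].
  by apply/funext => j; apply: hM => i iM; apply/vw/(leq_trans iM)/leq_bigmax.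
- by exists M => v w /h vw; rewrite vw.
- exists (maxn M1 M2) => v w vw; rewrite (h1 v w) 1?(h2 v w)// => i iM;
    by apply: vw; rewrite leq_max iM ?orbT.
- exists M => v w vw; split=> -[c hc]; exists c; move: hc; apply h => i iM;
    by rewrite /update; case: eqP => // _; rewrite vw.
Qed.

Fixpoint term_rename (s : nat -> nat) t : term S :=
  match t with
  | TVar i => TVar S (s i)
  | TZero => TZero S
  | TAdd t1 t2 => TAdd (term_rename s t1) (term_rename s t2)
  | TApp f ts => TApp (fun j => term_rename s (ts j))
  end.

Lemma teval_rename s v t : teval v (term_rename s t) = teval (v \o s) t.
Proof.
elim: t => [//|//|t1 h1 t2 h2|f ts ih] /=; first by rewrite h1 h2.
by congr finterp; apply/funext.
Qed.

(* The bound variable is sent to an index exceeding the image under [s] of every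
   variable of the body, so that an arbitrary [s] captures nothing. *)
Lemma sat_rename phi (s : nat -> nat) :
  exists psi : formula S, forall v, sat v psi <-> sat (v \o s) phi.
Proof.
elim: phi s => [t1 t2|t1 t2|p ts|phi ih|phi1 ih1 phi2 ih2|k phi ih] s /=.
- by exists (FEq (term_rename s t1) (term_rename s t2)) => v /=; rewrite !teval_rename.
- by exists (FLt (term_rename s t1) (term_rename s t2)) => v /=; rewrite !teval_rename.
- exists (FRel (fun j => term_rename s (ts j))) => v /=.
  by under eq_fun do rewrite teval_rename.
- by have [psi h] := ih s; exists (FNot psi) => v /=; rewrite h.
- have [psi1 h1] := ih1 s; have [psi2 h2] := ih2 s.
  by exists (FAnd psi1 psi2) => v /=; rewrite h1 h2.
- have [M hM] := sat_finite_support phi.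
  pose f := (\max_(j < M) s j).+1.
  have [psi h] := ih (fun i => if i == k then f else s i).
  exists (FEx f psi) => v /=.
  suff e c : sat (update v f c) psi <-> sat (update (v \o s) k c) phi.
    by split=> -[c /e hc]; exists c.
  rewrite h; apply: hM => i iM; rewrite /update /=.
  have [_|_] := eqVneq i k; first by rewrite eqxx.
  by rewrite ltn_eqF// ltnS (leq_bigmax (Ordinal iM)).
Qed.

End Renaming.

(** * Closure properties of definable predicates on environments *)

Section Definability.
Variables (R : realType) (S : expansion R).
Local Notation env := (nat -> R).
Implicit Types (v w : env).

Definition lookup v (a : nat + R) : R :=
  match a with inl i => v i | inr c => c end.

(* Definability with parameters of a predicate on environments: each variable of
   the formula reads either a coordinate of the environment or a constant. *)
Definition Def (P : env -> Prop) : Prop :=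
  exists (phi : formula S) (s : nat -> nat + R),
    forall v, P v <-> sat (fun i => lookup v (s i)) phi.

(* A definable family of subsets of [R]; the coordinate [0] of the longer
   environment is the point, the others are the indices of the family. *)
Definition DefFam (A : env -> set R) : Prop :=
  Def (fun w => A (fun i => w i.+1) (w 0%N)).

(** Sums are not atomic: they enter formulas only through [Def_ltD] and [Def_eqD]. *)
Definition atomic (t : env -> R) : Prop :=
  exists a, forall v, t v = lookup v a.

Definition atomic_env (r : env -> env) : Prop :=
  exists s, forall v i, r v i = lookup v (s i).

Lemma atomic_var i : atomic (fun v => v i).
Proof. by exists (inl i). Qed.

Lemma atomic_const c : atomic (fun=> c).
Proof. by exists (inr c). Qed.

Lemma atomic_env_rename (f : nat -> nat) : atomic_env (fun v i => v (f i)).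
Proof. by exists (fun i => inl (f i)). Qed.

Lemma atomic_env_const v : atomic_env (fun=> v).
Proof. by exists (fun i => inr (v i)). Qed.

Lemma atomic_env_update r t n :
  atomic_env r -> atomic t -> atomic_env (fun v => update (r v) n (t v)).
Proof.
move=> [s hs] [a ha]; exists (fun i => if i == n then a else s i) => v i.
by rewrite /update; case: eqP.
Qed.

Lemma Def_subst P r : Def P -> atomic_env r -> Def (fun v => P (r v)).
Proof.
move=> [phi [s hs]] [q hq].
exists phi, (fun i => match s i with inl j => q j | inr c => inr c end) => v.
rewrite hs; suff -> : (fun i => lookup (r v) (s i)) =
  (fun i => lookup v (match s i with inl j => q j | inr c => inr c end)) by [].
by apply/funext => i; case: (s i) => //= j.
Qed.

Lemma DefFam_app A r t : DefFam A -> atomic_env r -> atomic t ->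
  Def (fun v => A (r v) (t v)).
Proof.
move=> hA [s hs] [a ha].
have := @Def_subst _ (fun v i => if i is j.+1 then r v j else t v) hA.
by apply; exists (fun i => if i is j.+1 then s j else a) => v [|i].
Qed.

Lemma Def_not P : Def P -> Def (fun v => ~ P v).
Proof. by move=> [phi [s hs]]; exists (FNot phi), s => v /=; rewrite hs. Qed.

Lemma Def_and P Q : Def P -> Def Q -> Def (fun v => P v /\ Q v).
Proof.
move=> [phi [s hs]] [psi [q hq]].
(* Both formulas may use the same variable for different readings, so one is moved to the even
   variables and the other to the odd ones. *)
have [phi' h1] := sat_rename phi double.
have [psi' h2] := sat_rename psi (fun i => i.*2.+1).
exists (FAnd phi' psi'), (fun i => if odd i then q i./2 else s i./2) => v /=.
rewrite h1 h2 hs hq.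
have -> : (fun i => lookup v (if odd i then q i./2 else s i./2)) \o double =
  (fun i => lookup v (s i)).
  by apply/funext => i /=; rewrite odd_double doubleK.
suff -> : (fun i => lookup v (if odd i then q i./2 else s i./2)) \o
  (fun i => i.*2.+1) = (fun i => lookup v (q i)) by [].
by apply/funext => i /=; rewrite odd_double/= uphalf_double.
Qed.

Lemma Def_ext P Q : (forall v, P v <-> Q v) -> Def P -> Def Q.
Proof. by move=> PQ [phi [s hs]]; exists phi, s => v; rewrite -PQ. Qed.

Lemma Def_or P Q : Def P -> Def Q -> Def (fun v => P v \/ Q v).
Proof.
move=> hP hQ; apply: Def_ext (Def_not (Def_and (Def_not hP) (Def_not hQ))) => v.
by rewrite -not_orP notK.
Qed.

Lemma Def_imply P Q : Def P -> Def Q -> Def (fun v => P v -> Q v).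
Proof.
move=> hP hQ; apply: Def_ext (Def_or (Def_not hP) hQ) => v.
by rewrite implyE.
Qed.

(* [q] merges all formula variables that read the quantified point. *)
Lemma Def_ex (A : env -> R -> Prop) :
  Def (fun w => A (fun i => w i.+1) (w 0%N)) -> Def (fun v => exists y, A v y).
Proof.
move=> [phi [s hs]].
pose q i := if s i is inl 0%N then 0%N else i.+1.
have [psi h] := sat_rename phi q.
(* Slot 0 is overwritten by the quantified point; [inl k.-1] with [k = 0] is never read, since [q]
   sends such variables to slot 0. *)
exists (FEx 0 psi), (fun i => if i is j.+1 then
  match s j with inl k => inl k.-1 | inr c => inr c end else inr 0) => v /=.
suff e c : A v c <-> sat (update (fun i => lookup v (if i is j.+1 then
  match s j with inl k => inl k.-1 | inr c => inr c end else inr 0)) 0 c) psi.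
  by split=> -[c /e hc]; exists c.
rewrite h (hs (fun i => if i is j.+1 then v j else c)).
set f := (f in sat f _ <-> _); set g := (g in _ <-> sat g _).
suff -> : f = g by [].
apply/funext => i; rewrite /f /g /q /update /=.
by case e : (s i) => [[|k]|d] //=; rewrite e.
Qed.

Lemma Def_all (A : env -> R -> Prop) :
  Def (fun w => A (fun i => w i.+1) (w 0%N)) -> Def (fun v => forall y, A v y).
Proof.
move=> hA; apply: Def_ext (Def_not (@Def_ex (fun v y => ~ A v y) (Def_not hA))) => v.
by rewrite -forallNP; split=> h y; have := h y; rewrite ?notK.
Qed.

Lemma Def_lt t1 t2 : atomic t1 -> atomic t2 -> Def (fun v => t1 v < t2 v).
Proof.
move=> [a ha] [b hb].
exists (FLt (TVar S 0) (TVar S 1)), (fun i => if i is 0%N then a else b) => v /=.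
by rewrite ha hb.
Qed.

Lemma Def_ltD t1 t2 t3 : atomic t1 -> atomic t2 -> atomic t3 ->
  Def (fun v => t1 v < t2 v + t3 v).
Proof.
move=> [a ha] [b hb] [c hc].
exists (FLt (TVar S 0) (TAdd (TVar S 1) (TVar S 2))),
  (fun i => match i with 0 => a | 1 => b | _ => c end%N) => v /=.
by rewrite ha hb hc.
Qed.

Lemma Def_eq t1 t2 : atomic t1 -> atomic t2 -> Def (fun v => t1 v = t2 v).
Proof.
move=> [a ha] [b hb].
exists (FEq (TVar S 0) (TVar S 1)), (fun i => if i is 0%N then a else b) => v /=.
by rewrite ha hb.
Qed.

Lemma Def_eqD t1 t2 t3 t4 :
  atomic t1 -> atomic t2 -> atomic t3 -> atomic t4 ->
  Def (fun v => t1 v + t2 v = t3 v + t4 v).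
Proof.
move=> [a ha] [b hb] [c hc] [d hd].
exists (FEq (TAdd (TVar S 0) (TVar S 1)) (TAdd (TVar S 2) (TVar S 3))),
  (fun i => match i with 0 => a | 1 => b | 2 => c | _ => d end%N) => v /=.
by rewrite ha hb hc hd.
Qed.

Lemma Def_definable1 (D : set R) : Def (fun w => D (w 0%N)) -> definable1 S D.
Proof.
move=> [phi [s hs]].
(* [D] is tested at coordinate 0 only, so all coordinates may be set equal to the point: variables
   reading a coordinate become variable 0, the others parameters. *)
have [psi h] := sat_rename phi (fun i => if s i is inl _ then 0%N else i.+1).
exists psi, (fun i => if i is j.+1 then lookup (fun=> 0) (s j) else 0).
apply/seteqP; split=> x /=; rewrite h (hs (fun=> x ord0 ord0));
  set f := fun _ => lookup _ _; set g := _ \o _; suff -> : f = g by [].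
all: apply/funext => i; rewrite /f /g /=.
all: rewrite /valuation; case e : (s i) => [j|c] /=.
all: by case: insubP => [k _|//]; rewrite ?ord1//= => /esym; rewrite ?e// => -[].
Qed.

End Definability.

Ltac def_step := cbv beta; first
  [ assumption
  | apply: Def_and | apply: Def_or | apply: Def_not | apply: Def_all
  | apply: Def_ex | apply: Def_ltD | apply: Def_lt | apply: Def_eqD
  | apply: Def_eq | apply: DefFam_app | apply: Def_imply
  | apply: atomic_env_update | apply: atomic_env_rename | apply: atomic_env_const
  | apply: atomic_var | apply: atomic_const ].
Ltac def_auto := repeat def_step.

(** * Tame subsets of the real line *)

Section RealLine.
Variable R : realType.
Implicit Types (D E : set R) (a b d s t x y z : R).

Definition constant_on_ray D a : Prop :=
  exists2 d, 0 < d & (forall t, a < t < a + d -> D t) \/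
                     (forall t, a < t < a + d -> ~ D t).

Definition tame D : Prop := forall a,
  constant_on_ray D a /\ constant_on_ray [set t | D (- t)] (- a).

Definition frontier D : set R := [set a | ~ exists2 d, 0 < d &
  (forall t, a - d < t < a + d -> D t) \/ (forall t, a - d < t < a + d -> ~ D t)].

(** Asked at every [a], in [E] or not: [E] has no accumulation point on the line. *)
Definition discrete E : Prop := forall a,
  exists2 d, 0 < d & forall t, a - d < t < a + d -> E t -> t = a.

(** If [E] has points arbitrarily close to [a] on the right, convexity fills in between them. *)
Lemma interval_constant_on_ray E a : is_interval E -> constant_on_ray E a.
Proof.
move=> iE; have [[d d0 hd]|h] := pselect (exists2 d, 0 < d &
  forall t, a < t < a + d -> ~ E t).
  by exists d => //; right.
have near d : 0 < d -> exists2 t, a < t < a + d & E t.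
  move=> d0; apply: contrapT => h'; apply: h; exists d => // t ht Et.
  by apply: h'; exists t.
have [t0 t0a Et0] := near 1 ltr01.
exists (t0 - a); first lra.
left=> t ta; have [|t1 t1a Et1] := near (t - a); first lra.
by apply: (iE _ _ Et1 Et0); lra.
Qed.

Lemma constant_on_ray_bigcup (J : nat -> set R) m a :
  (forall i, (i < m)%N -> constant_on_ray (J i) a) ->
  constant_on_ray (\bigcup_(i in `I_m) J i) a.
Proof.
elim: m => [|m ih] h.
  by exists 1 => //; right => t _ [i].
have [|d d0 hd] := ih; first by move=> i im; apply/h/ltnW.
have [e e0 he] := h _ (ltnSn m).
exists (Num.min d e); first by rewrite lt_min d0.
have sub x : a < x < a + Num.min d e -> (a < x < a + d) /\ (a < x < a + e).
  by case: (leP d e) => de; split; lra.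
case: hd => hd; last case: he => he.
- left=> t /sub[/hd [i im Jt] _]; exists i => //; exact: ltnW.
- by left=> t /sub[_ /he Jt]; exists m => /=.
- right=> t /sub[ht1 ht2] [i /=]; rewrite ltnS leq_eqVlt => /predU1P[->|im] Jt.
    exact: he ht2 Jt.
  by apply: hd ht1 _; exists i.
Qed.

Lemma constant_on_ray_local D E a d : 0 < d ->
  (forall t, a < t < a + d -> D t <-> E t) ->
  constant_on_ray E a -> constant_on_ray D a.
Proof.
move=> d0 DE [e e0 he]; exists (Num.min d e); first by rewrite lt_min d0.
have sub x : a < x < a + Num.min d e -> (a < x < a + d) /\ (a < x < a + e).
  by case: (leP d e) => de; split; lra.
by case: he => he; [left|right] => t /sub[h1 /he]; rewrite DE.
Qed.

Lemma open_interval_nbhs (I : set R) a : open_interval I -> I a ->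
  exists2 d, 0 < d & forall t, a - d < t < a + d -> I t.
Proof.
move=> [x [y [_ ->]]] /= /andP[xa ay].
have [d1 d10 hd1] : exists2 d, 0 < d & forall t, a - d < t -> (x < t%:E)%E.
  case: x xa => [x|//|] xa.
  - exists (a - x); first by rewrite subr_gt0 -lte_fin.
    by move=> t; rewrite lte_fin; lra.
  - by exists 1 => // t _; rewrite ltNyr.
have [d2 d20 hd2] : exists2 d, 0 < d & forall t, t < a + d -> (t%:E < y)%E.
  case: y ay => [y||//] ay.
  - exists (y - a); first by rewrite subr_gt0 -lte_fin.
    by move=> t; rewrite lte_fin; lra.
  - by exists 1 => // t _; rewrite ltry.
exists (Num.min d1 d2); first by rewrite lt_min d10.
by move=> t; case: (leP d1 d2) => dd ht; rewrite hd1 ?hd2//; lra.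
Qed.

Lemma locally_ominimal_tame (S : expansion R) D :
  locally_ominimal S -> definable1 S D -> tame D.
Proof.
move=> hS hD a; have [I [oI Ia [m [J [hJ DJ]]]]] := hS D hD a.
have iJ i : (i < m)%N -> is_interval (J i).
  move=> /hJ[[c ->]|[x [y [_ ->]]]] u v /=.
    by move=> -> -> z; rewrite -eq_le => /eqP.
  move=> /andP[xu uy] /andP[xv vy] z /andP[uz zv].
  by rewrite (lt_le_trans xu) ?(le_lt_trans _ vy).
have [d d0 hd] := open_interval_nbhs oI Ia.
have DJE t : a - d < t < a + d -> D t <-> (\bigcup_(i in `I_m) J i) t.
  by move=> /hd It; rewrite -DJ; split=> [|[]].
split.
- apply: (constant_on_ray_local d0 (E := \bigcup_(i in `I_m) J i)).
    by move=> t ht; apply: DJE; lra.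
  by apply: constant_on_ray_bigcup => i im; apply/interval_constant_on_ray/iJ.
- apply: (constant_on_ray_local d0
      (E := \bigcup_(i in `I_m) [set t | J i (- t)])).
    by move=> t ht; apply: DJE; lra.
  apply: constant_on_ray_bigcup => i im; apply: interval_constant_on_ray.
  by move=> u v /= Ju Jv z uzv; apply: (iJ _ im _ _ Jv Ju); lra.
Qed.

(** By Bolzano-Weierstrass an infinite bounded set has a limit point, where discreteness fails. *)
Lemma discrete_bounded_finite E M : discrete E ->
  (forall x, E x -> - M < x < M) -> finite_set E.
Proof.
move=> dE bE; apply: contrapT => infE.
have bdE : bounded_set E.
  exists M; split; first exact: num_real.
  move=> x Mx y /bE /= yM; rewrite ler_norml; lra.
have [a la] := infinite_bounded_limit_point_nonempty infE bdE.
have [d d0 hd] := dE a.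
have [|y [ya Ey]] := la (ball a d); first exact: nbhsx_ballx.
rewrite /ball/= ltr_distlC => yd.
by move/eqP: ya; apply; apply: hd.
Qed.

Lemma discreteS E D : E `<=` D -> discrete D -> discrete E.
Proof. by move=> ED dD a; have [d d0 h] := dD a; exists d => // t ht /ED/h->. Qed.

Lemma discrete_countable E : discrete E -> countable E.
Proof.
move=> dE.
have -> : E = \bigcup_(k : nat) (E `&` [set x | - k%:R < x < k%:R]).
  apply/seteqP; split=> [x Ex|x [k _ []]//].
  exists (Num.bound `|x|) => //; split => //=.
  by rewrite -ltr_norml; apply: (archi_boundP (normr_ge0 x)).
apply: bigcup_countable => [|k _]; first exact: countableP.
apply: finite_set_countable; apply: (@discrete_bounded_finite _ k%:R).
  by apply: discreteS dE => x [].
by move=> x [].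
Qed.

(** [D] is constant on a short open ray on each side of [a], and no point of these rays is in the
    frontier. *)
Lemma tame_frontier_discrete D : tame D -> discrete (frontier D).
Proof.
move=> tD a; have [[d d0 hd] [e e0 he]] := tD a.
exists (Num.min d e); first by rewrite lt_min d0.
move=> t ht; apply: contra_notP => ta.
have sub : (a - e < t < a + d).
  by move: ht; case: (leP d e) => de; lra.
have {ta}[at_|ta] : a < t \/ t < a by case: (ltgtP t a) ta => //; [right|left].
- exists (Num.min (t - a) (a + d - t)).
    by rewrite lt_min; lra.
  have sub' u : t - Num.min (t - a) (a + d - t) < u < t + Num.min (t - a) (a + d - t)
     -> a < u < a + d.
    by case: (leP (t - a) (a + d - t)); lra.
  by case: hd => hd; [left|right] => u /sub'/hd.
- exists (Num.min (a - t) (t - (a - e))).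
    by rewrite lt_min; lra.
  have sub' u : t - Num.min (a - t) (t - (a - e)) < u < t + Num.min (a - t) (t - (a - e))
     -> - a < - u < - a + e.
    by case: (leP (a - t) (t - (a - e))); lra.
  by case: he => he; [left|right] => u /sub'/he /=; rewrite opprK.
Qed.

(** A countable set has Lebesgue measure zero. *)
Lemma itv_uncountable D a b : a < b -> (forall t, a < t < b -> D t) -> ~ countable D.
Proof.
move=> ab h cD.
have cI : countable (`]a, b[%classic : set R).
  apply: sub_countable cD; apply: subset_card_le => t /=.
  by rewrite in_itv /=; apply: h.
have := countable_lebesgue_measure0 cI.
by rewrite lebesgue_measure_itv /= lte_fin ab => /eqP; rewrite eqe subr_eq0 gt_eqF.
Qed.

(** Near [a], each side lies in [D] or misses it; a countable [D] contains no interval, so both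
    sides miss it. *)
Lemma countable_tame_discrete D : tame D -> countable D -> discrete D.
Proof.
move=> tD cD a; have [[d d0 hd] [e e0 he]] := tD a.
exists (Num.min d e); first by rewrite lt_min d0.
move=> t ht Dt.
have sub : (a - e < t < a + d).
  by move: ht; case: (leP d e) => de; lra.
case: hd => hd.
  by exfalso; apply: (@itv_uncountable D a (a + d)) => //; lra.
case: he => he.
  exfalso; apply: (@itv_uncountable D (a - e) a) => //; first lra.
  by move=> u hu; rewrite -(opprK u); apply: he; lra.
case: (ltgtP t a) => // ta; exfalso.
- by apply: (he (- t)); [lra|rewrite /= opprK].
- by apply: (hd t) => //; lra.
Qed.

(** Connectedness of the segment: local constancy at the supremum of the points up to which [Q]
    agrees with [Q a] would push it further, unless [b] is reached. *)
Lemma locally_constant_segment (Q : R -> Prop) a b : a <= b ->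
  (forall x, a <= x <= b -> exists2 d, 0 < d &
     forall t, x - d < t < x + d -> Q t <-> Q x) ->
  Q a <-> Q b.
Proof.
move=> ab h.
pose E := [set x | a <= x <= b /\ (Q x <-> Q a)].
suff: E b by move=> [_ ->].
pose F := [set x | a <= x <= b /\ forall y, a <= y <= x -> (Q y <-> Q a)].
have Fa : F a.
  split; first lra.
  by move=> y ya; have -> : y = a by lra.
have hF : has_sup F by split; [exists a | exists b => x [xab _]; lra].
have Fub x : F x -> x <= sup F by move=> Fx; apply: ub_le_sup => //; case: hF.
have asup := Fub _ Fa.
have supb : sup F <= b by apply: ge_sup; [exists a|move=> x [xab _]; lra].
have [d d0 hd] := h (sup F) ltac:(lra).
have [z [zab hz] zsup] := sup_adherent d0 hF.
have zF : z <= sup F by apply: Fub.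
have Qsup : Q (sup F) <-> Q a.
  rewrite -(hz z); last lra.
  by rewrite (hd z) //; lra.
have Qlt y : a <= y < sup F + d -> Q y <-> Q a.
  move=> hy; have [yz|zy] := leP y z; first by apply: hz; lra.
  by rewrite (hd y) //; lra.
split; first lra.
apply: (Qlt b); rewrite ab /= ltNge; apply/negP => bd.
have /Fub : F (sup F + d / 2); last lra.
by split; [lra|move=> y hy; apply: Qlt; lra].
Qed.

Lemma discrete_pred E s : discrete E -> ~ E s -> (exists2 b, E b & b < s) ->
  exists b, [/\ E b, b < s & forall x, b < x <= s -> ~ E x].
Proof.
move=> dE nEs [b0 Eb0 b0s].
pose F := [set b | E b /\ b < s].
have hF : has_sup F by split; [exists b0 | exists s => x [_ /ltW]].
have Fub x : F x -> x <= sup F by move=> Fx; apply: ub_le_sup => //; case: hF.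
have sups : sup F <= s by apply: ge_sup; [exists b0|move=> x [_ /ltW]].
have [d d0 hd] := dE (sup F).
have [z [Ez zs] zsup] := sup_adherent d0 hF.
have zF : z <= sup F by apply: Fub.
(* The supremum is attained, since points of [E] cannot accumulate at it. *)
have ze : z = sup F by apply: hd => //; lra.
exists z; split=> // x /andP[zx]; rewrite le_eqVlt => /predU1P[->//|xs Ex].
by have := Fub x (conj Ex xs); lra.
Qed.

Lemma discreteN E : discrete E -> discrete [set x | E (- x)].
Proof.
move=> dE a; have [d d0 hd] := dE (- a); exists d => // t ht /hd.
by move=> e; apply: oppr_inj; apply: e; lra.
Qed.

Lemma discrete_succ E s : discrete E -> ~ E s -> (exists2 b, E b & s < b) ->
  exists b, [/\ E b, s < b & forall x, s <= x < b -> ~ E x].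
Proof.
move=> /discreteN dE nEs [b Eb sb].
have [||c [Ec cs h]] := @discrete_pred _ (- s) dE.
- by rewrite /= opprK.
- by exists (- b); rewrite /= ?opprK//; lra.
exists (- c); split => //; first lra.
by move=> x hx; have := h (- x); rewrite /= opprK; apply; lra.
Qed.

(** * Separation and size of finite sets *)

Lemma seq_separated (l : seq R) : exists2 e, 0 < e &
  forall x y, x \in l -> y \in l -> x - e < y < x + e -> x = y.
Proof.
elim: l => [|a l [e e0 ih]]; first by exists 1.
have [d d0 hd] : exists2 d, 0 < d &
    forall y, y \in l -> a - d < y < a + d -> a = y.
  elim: l {ih} => [|b l [d d0 ih]]; first by exists 1.
  have [ab|ab] := eqVneq a b.
    exists d => // y; rewrite inE => /predU1P[-> //|]; exact: ih.
  exists (Num.min d `|a - b|); first by rewrite lt_min d0 normr_gt0 subr_eq0.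
  move=> y; rewrite inE => /predU1P[->|yl] h.
    have : `|a - b| < Num.min d `|a - b| by rewrite ltr_norml; lra.
    by rewrite lt_min ltxx andbF.
  by apply: ih => //; move: h; case: (leP d `|a - b|); lra.
exists (Num.min d e); first by rewrite lt_min d0.
move=> x y; rewrite !inE => /predU1P[->|xl] /predU1P[->|yl] // h.
- by apply: hd => //; move: h; case: (leP d e); lra.
- by apply/esym/hd => //; move: h; case: (leP d e); lra.
- by apply: ih => //; move: h; case: (leP d e); lra.
Qed.

Definition atmost K E : Prop :=
  exists2 l : seq R, (size l <= K)%N & forall x, E x -> x \in l.

Lemma atmostS K E D : E `<=` D -> atmost K D -> atmost K E.
Proof. by move=> ED [l lK h]; exists l => // x /ED/h. Qed.

Lemma finite_atmost E : finite_set E -> exists K, atmost K E.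
Proof. by move=> /finite_seqP[l ->]; exists (size l); exists l. Qed.

Lemma atmost_transfer K E D (r : R -> R -> Prop) :
  (forall y, D y -> exists2 x, E x & r x y) ->
  (forall x y y', E x -> D y -> D y' -> r x y -> r x y' -> y = y') ->
  atmost K E -> atmost K D.
Proof.
move=> tot fct [l lK h].
(* The default [0], for an [x] without partner, only adds a harmless entry to the list. *)
pose f x := xget 0 [set y | D y /\ r x y].
exists (map f l); first by rewrite size_map.
move=> y Dy; have [x Ex rxy] := tot y Dy.
apply/mapP; exists x; first exact: h.
have [Df rf] : [set y | D y /\ r x y] (f x) by apply: (@xgetPex _ 0); exists y.
exact: fct rxy rf.
Qed.

End RealLine.

(** * Uniform finiteness *)

Section Jumps.
Variable R : realType.
Implicit Types (X : R -> set R) (E D : set R) (e d s t x y z : R).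

(** This is [|x - y| < e], written without subtraction so that [Def_ltD] applies. *)
Definition close e x y : Prop := x < y + e /\ y < x + e.

(** Closeness is the graph of a bijection, expressed in first-order form. *)
Definition matched e E D : Prop :=
  [/\ forall x, E x -> exists y, D y /\ close e x y,
      forall y, D y -> exists x, E x /\ close e x y,
      forall x, E x -> forall y, D y -> forall y', D y' ->
        close e x y -> close e x y' -> y = y' &
      forall y, D y -> forall x, E x -> forall x', E x' ->
        close e x y -> close e x' y -> x = x'].

Lemma matched_atmost e E D K : matched e E D -> atmost K E <-> atmost K D.
Proof.
move=> [h1 h2 h3 h4]; split.
- apply: (atmost_transfer (r := close e)).
  + by move=> y /h2[x [Ex xy]]; exists x.
  + by move=> x y y' Ex Dy Dy'; apply: h3.
- apply: (atmost_transfer (r := fun y x => close e x y)).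
  + by move=> x /h1[y [Dy xy]]; exists y.
  + by move=> y x x' Dy Ex Ex'; apply: h4.
Qed.

Definition jump X s : Prop := ~ exists e d, [/\ 0 < e, 0 < d &
  forall t, s < t + d -> t < s + d -> matched e (X s) (X t)].

Lemma no_jump_atmost X K a b : a <= b ->
  (forall x, a <= x <= b -> ~ jump X x) -> atmost K (X a) <-> atmost K (X b).
Proof.
move=> ab h; apply: (@locally_constant_segment _ (fun t => atmost K (X t))) => //.
move=> x /h /contrapT[e [d [e0 d0 hd]]]; exists d => // t ht.
by rewrite -(@matched_atmost e (X x)) //; apply: hd; lra.
Qed.

Definition in_rat_itv (p : rat * rat) y : Prop := ratr p.1 < y /\ y < ratr p.2.

Fixpoint in_rat_itvs (l : seq (rat * rat)) y : Prop :=
  if l is p :: l' then in_rat_itv p y \/ in_rat_itvs l' y else False.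

Lemma in_rat_itvsP l y :
  in_rat_itvs l y <-> exists2 p, p \in l & in_rat_itv p y.
Proof.
elim: l => [|p l ih] /=; first by split=> // -[].
rewrite ih; split.
- move=> [py|[q ql qy]]; first by exists p; rewrite ?mem_head.
  by exists q => //; rewrite inE ql orbT.
- by move=> [q]; rewrite inE => /predU1P[->|ql] qy; [left|right; exists q].
Qed.

(** Tests with rational data, hence countably many; passing them for a list of disjoint intervals
    puts the points of [X t] in bijection with the intervals. *)
Definition covered X l t : Prop := forall y, X t y -> in_rat_itvs l y.
Definition hit X p t : Prop := exists y, X t y /\ in_rat_itv p y.
Definition hit_once X p t : Prop := forall y y',
  X t y /\ X t y' -> in_rat_itv p y /\ in_rat_itv p y' -> y = y'.

Lemma not_frontier_near D s : ~ frontier D s -> D s ->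
  exists2 d, 0 < d & forall t, s - d < t < s + d -> D t.
Proof.
move=> /contrapT[d d0 [h|h]] Ds; first by exists d.
by exfalso; apply: (h s) => //; lra.
Qed.

Lemma near_all_seq (T : eqType) (l : seq T) (P : T -> set R) s :
  (forall i, i \in l -> exists2 d, 0 < d & forall t, s - d < t < s + d -> P i t) ->
  exists2 d, 0 < d & forall t, s - d < t < s + d -> forall i, i \in l -> P i t.
Proof.
elim: l => [|a l ih] h; first by exists 1.
have [|d d0 hd] := ih; first by move=> x xl; apply: h; rewrite inE xl orbT.
have [e e0 he] := h a (mem_head _ _).
exists (Num.min d e); first by rewrite lt_min d0.
move=> t ht x; rewrite inE => /predU1P[->|xl].
- by apply: he; move: ht; case: (leP d e); lra.
- by apply: hd => //; move: ht; case: (leP d e); lra.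
Qed.

(* Isolate the points of [X s] by rational intervals: away from the frontiers of
   the countably many tests, nearby [X t] have one point in each of them and no other. *)
Lemma jump_countable X : (forall t, finite_set (X t)) ->
  (forall l, tame (covered X l)) -> (forall p, tame (hit X p)) ->
  (forall p, tame (hit_once X p)) -> countable (jump X).
Proof.
move=> fX t1 t2 t3.
suff sub : jump X `<=` \bigcup_(l : seq (rat * rat)) frontier (covered X l) `|`
    \bigcup_(p : rat * rat) (frontier (hit X p) `|` frontier (hit_once X p)).
  apply: sub_countable (subset_card_le sub) _.
  rewrite -bigcup2E; apply: bigcup_countable => [|i _]; first exact: countableP.
  have cf D : tame D -> countable (frontier D).
    by move=> tD; apply/discrete_countable/tame_frontier_discrete.
  rewrite /bigcup2; case: eqP => _; [|case: eqP => _].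
  - apply: bigcup_countable => [|l _]; first exact: countableP.
    exact/cf/t1.
  - apply: bigcup_countable => [|p _]; first exact: countableP.
    rewrite -bigcup2E; apply: bigcup_countable => [|j _]; first exact: countableP.
    rewrite /bigcup2; case: eqP => _; [|case: eqP => _] => //.
    + exact/cf/t2.
    + exact/cf/t3.
  - exact: countable0.
move=> s Js; apply: contrapT => /not_orP[n1 n2]; apply: Js.
have {}n1 l : ~ frontier (covered X l) s by move=> h; apply: n1; exists l.
have {}n2 p : ~ frontier (hit X p) s /\ ~ frontier (hit_once X p) s.
  by apply/not_orP => h; apply: n2; exists p.
have /finite_seqP[l Xl] := fX s.
have [e e0 he] := seq_separated l.
(* Distinct points of [X s] are at least [e] apart, so their intervals, kept within distance
   [e / 2], are disjoint. *)
have /choice[q hq] x : exists p, [/\ x - e / 2 < ratr p.1, in_rat_itv p x &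
    ratr p.2 < x + e / 2].
  have [p1] := @rat_in_itvoo R (x - e / 2) x ltac:(lra).
  have [p2] := @rat_in_itvoo R x (x + e / 2) ltac:(lra).
  rewrite !in_itv /= => h2 h1; exists (p1, p2); rewrite /in_rat_itv /=.
  by split; [|split|]; lra.
have near_q x y : in_rat_itv (q x) y -> x - e / 2 < y < x + e / 2.
  by have [] := hq x; rewrite /in_rat_itv; lra.
have [d1 d10 hd1] : exists2 d, 0 < d & forall t, s - d < t < s + d ->
    covered X (map q l) t.
  apply: not_frontier_near => // y; rewrite Xl /= => yl.
  apply/in_rat_itvsP; exists (q y); first exact: map_f.
  by have [] := hq y.
have [d2 d20 hd2] : exists2 d, 0 < d & forall t, s - d < t < s + d ->
    forall x, x \in l -> hit X (q x) t.
  apply: near_all_seq => x xl; have [nh _] := n2 (q x).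
  apply: not_frontier_near => //; exists x; rewrite Xl /=; split => //.
  by have [] := hq x.
have [d3 d30 hd3] : exists2 d, 0 < d & forall t, s - d < t < s + d ->
    forall x, x \in l -> hit_once X (q x) t.
  apply: near_all_seq => x xl; have [_ nh] := n2 (q x).
  apply: not_frontier_near => // y y'; rewrite Xl /= => -[yl y'l].
  by move=> [/near_q h /near_q h']; apply: he => //; lra.
exists (e / 2), (Num.min d1 (Num.min d2 d3)); split; first lra.
  by rewrite !lt_min d10 d20.
move=> t st ts.
have [{}/hd1 h1 [{}/hd2 h2 {}/hd3 h3]] : s - d1 < t < s + d1 /\
    (s - d2 < t < s + d2 /\ s - d3 < t < s + d3).
  move: st ts; case: (leP d2 d3) => h23; [case: (leP d1 d2)|case: (leP d1 d3)];
  move=> h12 h13 h14; do 2?split; lra.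
(* The covering interval containing [y] is that of some [z] with [|z - x| < e], and separation
   forces [z = x]. *)
have own x y : x \in l -> X t y -> close (e / 2) x y -> in_rat_itv (q x) y.
  move=> xl /h1/in_rat_itvsP[_ /mapP[z zl ->] qzy] [xy yx].
  by have := near_q _ _ qzy => zy; rewrite (he x z) //; lra.
rewrite Xl; split=> [x /= xl|y /[dup] Xy /h1/in_rat_itvsP[_ /mapP[x xl ->] qxy]
  |x /= xl y Xy y' Xy' cy cy'|y Xy x /= xl x' x'l [xy yx] [xy' yx']].
- have [y [Xy /near_q qy]] := h2 x xl.
  by exists y; split => //; split; lra.
- by exists x; split => //; have := near_q _ _ qxy; split; lra.
- by apply: (h3 x xl) => //; split; apply: own.
- by apply: he => //; lra.
Qed.

End Jumps.

(** * Induction on the number of parameters *)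

Section UniformFiniteness.
Variables (R : realType) (S : expansion R).
Local Notation env := (nat -> R).

Lemma Def_False : Def S (fun=> False).
Proof.
apply: (@Def_ext _ _ (fun=> (0 : R) < 0)); first by move=> v; rewrite ltxx.
by def_auto.
Qed.

Lemma Def_in_rat_itv p (t : env -> R) :
  atomic t -> Def S (fun v => in_rat_itv p (t v)).
Proof. by move=> ht; rewrite /in_rat_itv; def_auto. Qed.

Lemma Def_in_rat_itvs l (t : env -> R) :
  atomic t -> Def S (fun v => in_rat_itvs l (t v)).
Proof.
move=> ht; elim: l => [|p l ih] /=; first exact: Def_False.
by apply: Def_or => //; apply: Def_in_rat_itv.
Qed.

Lemma DefFam_definable1 (A : env -> set R) v : DefFam S A -> definable1 S (A v).
Proof. by move=> hA; apply: Def_definable1; def_auto. Qed.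

Lemma DefFam_jump (A : env -> set R) n : DefFam S A ->
  DefFam S (fun v => jump (fun t => A (update v n t))).
Proof.
move=> hA; rewrite /DefFam /jump.
(* The same condition with binary conjunctions, which [def_auto] can traverse. *)
apply: (@Def_ext _ _ (fun w => ~ exists e d, 0 < e /\ 0 < d /\
  forall t, w 0%N < t + d -> t < w 0%N + d ->
  let E := A (update (fun i => w i.+1) n (w 0%N)) in
  let D := A (update (fun i => w i.+1) n t) in
  (forall x, E x -> exists y, D y /\ close e x y) /\
  (forall y, D y -> exists x, E x /\ close e x y) /\
  (forall x, E x -> forall y, D y -> forall y', D y' ->
        close e x y -> close e x y' -> y = y') /\
  (forall y, D y -> forall x, E x -> forall x', E x' ->
        close e x y -> close e x' y -> x = x'))).
  move=> v; suff h (P Q : Prop) : (P <-> Q) -> (~ P <-> ~ Q).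
    apply: h; split.
    - move=> [e [d [e0 [d0 h]]]]; exists e, d; split=> // t st ts.
      by have [h1 [h2 [h3 h4]]] := h t st ts.
    - move=> [e [d [e0 d0 h]]]; exists e, d; do 2!split=> //.
      by move=> t st ts; have [h1 h2 h3 h4] := h t st ts.
  by move=> PQ; rewrite PQ.
by rewrite /close; cbv zeta; def_auto.
Qed.

(** Environments are infinite; this expresses that the family has only [n] parameters. *)
Definition depends_below n (A : env -> set R) : Prop :=
  forall v w, (forall i, (i < n)%N -> v i = w i) -> A v = A w.

(* A countable set, definable from [E], that contains [E] and meets every
   component of the complement of [E]. *)
Definition sample (E : set R) (c : R) : Prop :=
  c = 0 \/ exists b b', (E b /\ E b') /\
    (c + c = b + b' \/ (c + 0 = b + 1 \/ c + 1 = b + 0)).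

Lemma sample_countable (E : set R) : countable E -> countable (sample E).
Proof.
move=> cE.
have sub : sample E `<=` \bigcup_(b in E) \bigcup_(b' in E)
    [set` [:: (b + b') / 2; b + 1; b - 1]] `|` [set 0].
  move=> c [->|[b [b' [[Eb Eb'] h]]]]; [by right|left].
  exists b => //; exists b' => //=; rewrite !inE.
  case: h => [h|[h|h]].
  - have -> : c = (b + b') / 2 by lra.
    by rewrite eqxx.
  - have -> : c = b + 1 by lra.
    by rewrite eqxx orbT.
  - have -> : c = b - 1 by lra.
    by rewrite eqxx !orbT.
apply: sub_countable (subset_card_le sub) _.
rewrite -bigcup2E; apply: bigcup_countable => [|i _]; first exact: countableP.
rewrite /bigcup2; case: eqP => _; [|case: eqP => _].
- apply: bigcup_countable => // b _; apply: bigcup_countable => // b' _.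
  exact/finite_set_countable/finite_seq.
- exact/finite_set_countable/finite_set1.
- exact: countable0.
Qed.

(** Midpoints serve the bounded gaps of [E], shifts by 1 the unbounded ones, and [0] the case of
    empty [E]; a point of [E] is its own midpoint. *)
Lemma sample_same_component (E : set R) s : discrete E ->
  exists2 c, sample E c & E s /\ c = s \/
    (forall x, Num.min c s <= x <= Num.max c s -> ~ E x).
Proof.
move=> dE; have [Es|nEs] := pselect (E s).
  by exists s; [right; exists s, s; do !split => //; left|left].
have [/(discrete_pred dE nEs)[b [Eb bs hb]]|nb] := pselect (exists2 b, E b & b < s);
have [/(discrete_succ dE nEs)[b' [Eb' sb' hb']]|nb'] := pselect (exists2 b, E b & s < b).
- exists ((b + b') / 2).
    by right; exists b, b'; split => //; left; lra.
  right=> x; case: (leP ((b + b') / 2) s) => _ hx.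
  + by apply: hb; lra.
  + by apply: hb'; lra.
- exists (b + 1); first by right; exists b, b; split=> //; right; left; lra.
  right=> x hx Ex; have [xs|sx] := leP x s.
  + by apply: (hb x) => //; move: hx; case: (leP (b + 1) s); lra.
  + by apply: nb'; exists x.
- exists (b' - 1); first by right; exists b', b'; split=> //; right; right; lra.
  right=> x hx Ex; have [xs|sx] := ltP x s.
  + by apply: nb; exists x.
  + by apply: (hb' x) => //; move: hx; case: (leP (b' - 1) s); lra.
- exists 0; first by left.
  right=> x _ Ex; case: (ltgtP x s) => xs.
  + by apply: nb; exists x.
  + by apply: nb'; exists x.
  + by apply: nEs; rewrite -xs.
Qed.

(** The summands [0] in [sample] give its equations the shape of [Def_eqD]. *)
Lemma DefFam_sample (J A : env -> set R) n : DefFam S J -> DefFam S A ->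
  DefFam S (fun v y => exists c, sample (J v) c /\ A (update v n c) y).
Proof. by move=> hJ hA; rewrite /DefFam /sample; def_auto. Qed.

Lemma uniform_finiteness (hS : locally_ominimal S) n (A : env -> set R) :
  DefFam S A -> depends_below n A ->
  (forall v, finite_set (A v)) -> (forall v y, A v y -> -1 < y < 1) ->
  exists K, forall v, atmost K (A v).
Proof.
elim: n A => [|n ih] A hA dA fA bA.
  have [K hK] := finite_atmost (fA (fun=> 0)); exists K => v.
  by rewrite (dA v (fun=> 0)).
pose X v t := A (update v n t).
have tameX (Q : set R) : Def S (fun w => Q (w 0%N)) -> tame Q.
  by move=> /Def_definable1/(locally_ominimal_tame hS).
have cJ v : countable (jump (X v)).
  apply: jump_countable.
  - by move=> t; apply: fA.
  - move=> l; apply: (@tameX); rewrite /covered /X.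
    by apply: Def_all; apply: Def_imply; [def_auto|apply/Def_in_rat_itvs/atomic_var].
  - by move=> p; apply: (@tameX); rewrite /hit /X /in_rat_itv; def_auto.
  - by move=> p; apply: (@tameX); rewrite /hit_once /X /in_rat_itv; def_auto.
have hJ : DefFam S (fun v => jump (X v)) by apply: DefFam_jump.
have tJ v : tame (jump (X v)).
  exact: locally_ominimal_tame hS (DefFam_definable1 v hJ).
pose Y v y := exists c, sample (jump (X v)) c /\ X v c y.
(* Coordinate [n] is overwritten in [X], which leaves one parameter fewer for the induction. *)
have Xn v w t : (forall i, (i < n)%N -> v i = w i) -> X v t = X w t.
  move=> vw; apply: dA => i; rewrite ltnS leq_eqVlt /update => /predU1P[->|lin].
    by rewrite eqxx.
  by rewrite vw.
have hY : DefFam S Y := DefFam_sample n hJ hA.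
have [] := ih Y.
- exact: hY.
- move=> v w vw; rewrite /Y.
  by have -> : X v = X w by apply/funext => t; apply: Xn.
(* [Y v] is a countable union of finite sets; being definable it is then discrete, and bounded,
   hence finite. *)
- move=> v; apply: (@discrete_bounded_finite _ _ 1); last first.
    by move=> x [c [_ /bA]].
  apply: countable_tame_discrete; first exact: locally_ominimal_tame hS (DefFam_definable1 v hY).
  have -> : Y v = \bigcup_(c in sample (jump (X v))) X v c.
    by apply/seteqP; split=> [y [c [? ?]]|y [c ? ?]]; exists c.
  apply: bigcup_countable => [|c _]; first exact: sample_countable.
  exact/finite_set_countable/fA.
- by move=> v y [c [_ /bA]].
move=> K hK; exists K => v.
(* Either [c] is [v n] or no jump lies between them, so the bound on [X v c], a subset of [Y v],
   carries over to [A v]. *)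
have [c Cc hc] := @sample_same_component (jump (X v)) (v n)
  (countable_tame_discrete (tJ v) (cJ v)).
have Av : A v = X v (v n).
  by congr A; apply/funext => i; rewrite /update; case: eqP => [->|].
have Xc : atmost K (X v c).
  by apply: atmostS (hK v) => y Xy; exists c.
rewrite Av; case: hc => [[_ <-]//|hc].
by move: Xc hc; case: (leP c (v n)) => [cs|sc] Xc hc;
  [rewrite -(no_jump_atmost K cs hc)|rewrite (no_jump_atmost K (ltW sc) hc)].
Qed.

End UniformFiniteness.

(** * Connected components of the fibers *)

Section Fibers.
Variables (R : realType) (S : expansion R).
Local Notation env := (nat -> R).

Definition fiber n (X : set 'rV[R]_(n + 1)) (v : env) (y : R) : Prop :=
  X (row_mx (\row_(i < n) v i) (const_mx y)).

Lemma DefFam_fiber n (X : set 'rV[R]_(n + 1)) :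
  definable S X -> DefFam S (fiber X).
Proof.
move=> [phi [p ->]].
(* Variable [n] reads the point, at index 0 of the longer environment, which shifts the smaller
   variables by one. *)
exists phi, (fun k => if (k < n)%N then inl k.+1
                      else if k == n then inl 0%N else inr (p k)) => w.
rewrite /fiber /=; set f := (f in sat f _ <-> _); set g := (g in _ <-> sat g _).
suff -> : f = g by [].
apply/funext => k; rewrite /f /g /valuation; case: insubP => [j _ <-|].
  rewrite mxE /=; case: (fintype.splitP j) => i -> /=.
    by rewrite mxE.
  by rewrite mxE (ord1 i) (_ : (n + (ord0 : 'I_1))%N == n) ?addn0.
by rewrite -leqNgt addn1 => nk; rewrite ltnNge (ltnW nk) /= gtn_eqF.
Qed.

Lemma DefFam_frontier (A : env -> set R) : DefFam S A ->
  DefFam S (fun v y => frontier (A v) y /\ (-1 < y /\ y < 1)).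
Proof.
move=> hA; apply: Def_and; last by def_auto.
apply: (@Def_ext _ _ (fun w => ~ exists d, 0 < d /\
   ((forall t, w 0%N < t + d /\ t < w 0%N + d -> A (fun i => w i.+1) t) \/
    (forall t, w 0%N < t + d /\ t < w 0%N + d -> ~ A (fun i => w i.+1) t)))).
  move=> w; rewrite /frontier /=; suff h (P Q : Prop) : (P <-> Q) -> (~ P <-> ~ Q).
    apply: h; split=> [[d [d0 h]]|[d d0 h]]; exists d => //.
    + by case: h => h; [left|right] => t ht; apply: h; lra.
    + by split => //; case: h => h; [left|right] => t ht; apply: h; lra.
  by move=> PQ; rewrite PQ.
by def_auto.
Qed.

Lemma row_mx_const_continuous n (a : 'rV[R]_n) :
  continuous (fun y : R => row_mx a (const_mx y : 'rV[R]_1)).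
Proof.
move=> y; apply/cvg_ballP => e e0; near=> z; split=> // i j.
rewrite !mxE; case: fintype.split => k; first exact: ballxx.
rewrite !mxE; near: z; by exists e.
Unshelve. all: by end_near. Qed.

(** Even codes stand for the gaps left by the points of [l], odd codes for these points
    themselves. *)
Definition gap_code (l : seq R) (y : R) : nat :=
  ((count (fun b => b < y)%R l).*2 + (y \in l))%N.

Lemma gap_code_lt l y K : (size l <= K)%N -> (gap_code l y < K.*2.+2)%N.
Proof.
move=> lK; rewrite ltnS -[K.*2.+1]addn1 leq_add ?leq_b1 // leq_double.
exact: leq_trans (count_size _ _) lK.
Qed.

(** Parity gives membership in [l], the half the number of entries below. Equal counts exclude
    entries in [[y, y'[]; so [y] is not in [l], and hence neither is [y']. *)
Lemma gap_code_eq l y y' b : y < y' -> gap_code l y = gap_code l y' ->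
  y <= b <= y' -> b \notin l.
Proof.
move=> yy' ecode.
have [ecount emem] : count (fun x => x < y) l = count (fun x => x < y') l /\
    (y \in l) = (y' \in l).
  have := congr1 odd ecode; rewrite /gap_code !oddD !odd_double /= !oddb => e.
  split=> //; move: ecode; rewrite /gap_code e => /addIn/(congr1 half).
  by rewrite !doubleK.
have out c : c \in l -> ~~ (y <= c < y').
  apply: contraL => /andP[yc cy'].
  have := count_predUI (fun x => x < y) (fun x => y <= x < y') l.
  have /eq_count-> : predU (fun x => x < y) (fun x => y <= x < y') =1 (fun x => x < y').
    by move=> x /=; case: (ltP x y) => //= xy; rewrite (lt_trans xy).
  have /eq_count-> : predI (fun x => x < y) (fun x => y <= x < y') =1 pred0.
    by move=> x /=; case: ltP.
  rewrite count_pred0 addn0 ecount => /eqP.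
  rewrite -[X in X == _]addn0 eqn_add2l eq_sym => /eqP/esym/eqP.
  rewrite eq_sym -leqn0 leqNgt -has_count; apply: contra => cl.
  by apply/hasP; exists c => //; rewrite yc.
move=> /andP[yb]; rewrite le_eqVlt => /predU1P[->|by']; last first.
  by apply/negP => /out; rewrite yb by'.
by rewrite -emem; apply/negP => /out; rewrite lexx yy'.
Qed.

Lemma fiber_components n (X : set 'rV[R]_(n + 1)) (v : env) K :
  atmost K [set y | frontier (fiber X v) y /\ (-1 < y /\ y < 1)] ->
  components (X `&` [set row_mx (\row_(i < n) v i) (const_mx y) | y in `]-1, 1[])
    #<= `I_(K.*2.+2).
Proof.
move=> [l lK hl]; set T := X `&` _.
pose pt y : 'rV[R]_(n + 1) := row_mx (\row_(i < n) v i) (const_mx y).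
pose U := [set y | -1 < y < 1 /\ fiber X v y].
have same y y' : y < y' -> U y -> U y' -> gap_code l y = gap_code l y' ->
    connected_component T (pt y) = connected_component T (pt y').
  move=> yy' [hy Uy] [hy' Uy'] e; apply: same_connected_component.
  apply: (@connected_component_max _ _ (pt @` `[y, y'])).
  - by exists y => //=; rewrite in_itv /= lexx ltW.
  - move=> ? [z /=]; rewrite in_itv /= => hz <-; split; last first.
      by exists z => //=; rewrite in_itv /=; lra.
    (* The segment avoids the frontier, so membership in the fiber propagates from [y] to [z]. *)
    apply/(@locally_constant_segment _ (fiber X v) y z) => //; first lra.
    move=> x hx.
    have /contrapT[d d0 hd] : ~ frontier (fiber X v) x.
      move=> fx; have := @gap_code_eq _ _ _ x yy' e ltac:(lra).
      by rewrite hl //; split => //; lra.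
    exists d => // t ht.
    case: hd => hd; first by split=> _; apply: hd; lra.
    split=> h; exfalso; first exact: (hd t).
    by apply: (hd x) => //; lra.
  - apply: connected_continuous_connected; first exact: segment_connected.
    exact/continuous_subspaceT/row_mx_const_continuous.
  - by exists y' => //=; rewrite in_itv /= lexx ltW.
(* One representative per code; the default [0] occurs only for codes that no point of [U] has. *)
pose g k := connected_component T (pt (xget 0 [set y | U y /\ gap_code l y = k])).
have sub : components T `<=` g @` `I_(K.*2.+2).
  move=> ? [? [Xy [y /= hy ye]] <-]; rewrite -ye in Xy *.
  have Uy : U y by rewrite in_itv /= in hy.
  exists (gap_code l y); first exact: gap_code_lt.
  rewrite /g; set y0 := xget _ _.
  have [Uy0 e0] : [set z | U z /\ gap_code l z = gap_code l y] y0.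
    by apply: (@xgetPex _ 0); exists y.
  by case: (ltgtP y0 y) => [h|h|->//]; [|symmetry]; apply: same.
exact: card_le_trans (subset_card_le sub) (card_image_le _ _).
Qed.

End Fibers.

Theorem theorem4p3 (R : realType) (S : expansion R) (hS : locally_ominimal S)
    (n : nat) (X : set 'rV[R]_(n + 1)) (hX : definable S X) :
  exists (r : R) (K : nat), [/\ 0 < r, (0 < K)%N &
    forall a : 'rV[R]_n,
      components (X `&` [set row_mx a (const_mx y) | y in `]- r, r[]) #<= `I_K].
Proof.
have hF := DefFam_fiber hX.
have [|||K hK] := @uniform_finiteness _ _ hS n _ (DefFam_frontier hF).
- move=> v w vw; suff -> : fiber X v = fiber X w by [].
  apply/funext => y; rewrite /fiber; congr (X (row_mx _ _)).
  by apply/rowP => i; rewrite !mxE vw.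
- move=> v; apply: (@discrete_bounded_finite _ _ 1); last first.
    by move=> y [_ [h1 h2]]; rewrite h1.
  apply: (@discreteS _ _ (frontier (fiber X v))); first by move=> y [].
  exact/tame_frontier_discrete/(locally_ominimal_tame hS)/DefFam_definable1.
- by move=> v y [_ [h1 h2]]; rewrite h1.
(* The frontiers were cut to []-1, 1[], whence [r = 1]; the codes range from [0] to [2K + 1]. *)
exists 1, K.*2.+2; split=> // a.
pose v i := if insub i is Some j then a ord0 j else 0.
have -> : a = \row_(i < n) v i.
  by apply/rowP => i; rewrite mxE /v valK.
exact: fiber_components (hK v).
Qed.
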